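(* For complex $q$ with $|q|<1$, $f_2(q)=f_3(q)$, where $$f_2(q):=\sum_{k\geq1}\sum_{\ell\geq1}\frac{(k+\ell)\,q^{k+\ell+k \ell}}{(1-q^k)(1-q^{\ell})},\qquad f_3(q):=\sum_{k\geq1}\sum_{\ell>k}\frac{2k\,q^{k+\ell}}{(1-q^k)(1-q^{\ell})}.$$ *)

(* Defs.v *)
From Stdlib Require Import Reals.
From Coquelicot Require Import Coquelicot.

(* Coquelicot's [Series] is real-valued only.  A complex series converges iff
   its real and imaginary parts do; [CSeries_unique] relates this total sum to
   the normed-module predicate [is_series]. *)
Definition CSeries (a : nat -> C) : C :=
  (Series (fun n => Re (a n)), Series (fun n => Im (a n))).

Lemma CSeries_unique (a : nat -> C) (l : C) :
  is_series a l -> CSeries a = l.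
Proof.
  intros H.
  assert (HRe : forall n, Re (sum_n a n) = sum_n (fun k => Re (a k)) n).
  { induction n as [|n IH]; [now rewrite !sum_O|].
    now rewrite !sum_Sn, <- IH. }
  assert (HIm : forall n, Im (sum_n a n) = sum_n (fun k => Im (a k)) n).
  { induction n as [|n IH]; [now rewrite !sum_O|].
    now rewrite !sum_Sn, <- IH. }
  assert (H2 : forall P : C -> Prop,
             locally l P -> eventually (fun n => P (sum_n a n))).
  { intros P [e He]. apply H. exists e. exact He. }
  destruct l as [x y]. unfold CSeries. f_equal; apply is_series_unique.
  - intros P [e He]. unfold filtermap.
    destruct (H2 (fun z => P (Re z))) as [N HN].
    { exists e. intros z [Hz _]. now apply He. }
    exists N. intros n Hn. rewrite <- HRe. now apply HN.
  - intros P [e He]. unfold filtermap.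
    destruct (H2 (fun z => P (Im z))) as [N HN].
    { exists e. intros z [_ Hz]. now apply He. }
    exists N. intros n Hn. rewrite <- HIm. now apply HN.
Qed.

(* [sum_from m a] is a m + a (m+1) + a (m+2) + ... *)
Definition sum_from (m : nat) (a : nat -> C) : C :=
  CSeries (fun n => a (m + n)%nat).

(* Sum over k >= 1 and l >= m k, inner sum over l. *)
Definition double_sum (m : nat -> nat) (a : nat -> nat -> C) : C :=
  sum_from 1 (fun k => sum_from (m k) (a k)).

(* Absolute convergence of that double series, so that its sum does not depend
   on the order of summation. *)
Definition double_sum_converges (m : nat -> nat) (a : nat -> nat -> C) : Prop :=
  (forall k : nat, (1 <= k)%nat ->
     ex_series (fun n => Cmod (a k (m k + n)%nat))) /\
  ex_series (fun i => Series (fun n => Cmod (a (1 + i)%nat (m (1 + i) + n)%nat))).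

Local Open Scope C_scope.

Definition f2_term (q : C) (k l : nat) : C :=
  INR (k + l) * q ^ (k + l + k * l) / ((1 - q ^ k) * (1 - q ^ l)).

Definition f3_term (q : C) (k l : nat) : C :=
  2 * INR k * q ^ (k + l) / ((1 - q ^ k) * (1 - q ^ l)).

Definition f2 (q : C) : C := double_sum (fun _ => 1%nat) (f2_term q).

Definition f3 (q : C) : C := double_sum S (f3_term q).

(* Main.v *)
Require Import Defs.
From Stdlib Require Import Reals.
From Coquelicot Require Import Coquelicot.
From Stdlib Require Import Lra Lia.

(** After the factor [k q^k / (1 - q^k)] is pulled out, the inner sums of the
    two series agree for each [k]:
      sum_(l >= 1) q^(l (k+1)) / (1 - q^l) = sum_(l > k) q^l / (1 - q^l),
    since both sides are the sum of [q^(l m)] over [l >= 1], [m > k].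
    The weight [k + l] in [f2] becomes [2 k] by the symmetry of the remaining
    factors.  Each interchange of sums is justified by a bound of the general
    term by a product [u i * v j] of summable sequences. *)

(** * Real series: domination, tails and interchange of summation *)

Lemma ex_series_dominated (a b : nat -> R) :
  (forall n, Rabs (a n) <= b n) -> ex_series b -> ex_series a.
Proof.
  intros H Hb. apply (ex_series_le (K := R_AbsRing) (V := R_CompleteNormedModule) a b); auto.
Qed.

Lemma Series_dominated (a b : nat -> R) :
  (forall n, Rabs (a n) <= b n) -> ex_series b -> Rabs (Series a) <= Series b.
Proof.
  intros H Hb.
  eapply Rle_trans.
  - apply Series_Rabs. apply ex_series_dominated with b; auto.
    intros n. rewrite Rabs_Rabsolu. apply H.
  - apply Series_le; auto. intros n. split; [apply Rabs_pos | apply H].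
Qed.

Lemma Series_sum_n (a : nat -> nat -> R) (N : nat) :
  (forall i, ex_series (a i)) ->
  ex_series (fun j => sum_n (fun i => a i j) N) /\
  Series (fun j => sum_n (fun i => a i j) N) = sum_n (fun i => Series (a i)) N.
Proof.
  intros Ha. induction N as [|N [IHex IH]].
  - rewrite sum_O. split.
    + apply ex_series_ext with (a 0%nat); auto. intros j. now rewrite sum_O.
    + apply Series_ext. intros j. now rewrite sum_O.
  - assert (E : forall j, sum_n (fun i => a i j) N + a (S N) j
                          = sum_n (fun i => a i j) (S N)).
    { intros j. now rewrite sum_Sn. }
    split.
    + apply ex_series_ext with (1 := E).
      apply (ex_series_plus (V := R_NormedModule)); auto.
    + rewrite <- (Series_ext _ _ E), Series_plus, IH, sum_Sn by auto. reflexivity.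
Qed.

Lemma Series_tail (u : nat -> R) (N : nat) :
  ex_series u -> Series (fun i => u (S N + i)%nat) = Series u - sum_n u N.
Proof.
  intros Hu. rewrite (Series_incr_n u (S N)), sum_n_Reals by (auto; lia). simpl. ring.
Qed.

Lemma ex_series_scal_R (c : R) (v : nat -> R) :
  ex_series v -> ex_series (fun j => c * v j).
Proof. intros Hv. exact (ex_series_scal (V := R_NormedModule) c v Hv). Qed.

(** A finite number of rows commutes with the column sum. What remains after row [N] is the column
    sum of the tails, at most [Series v] times the tail of [u], which tends to 0. *)
Lemma Series_swap (a : nat -> nat -> R) (u v : nat -> R) :
  (forall i j, Rabs (a i j) <= u i * v j) -> ex_series u -> ex_series v ->
  Series (fun i => Series (a i)) = Series (fun j => Series (fun i => a i j)).
Proof.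
  intros Ha Hu Hv.
  assert (Hrow : forall i, ex_series (a i)).
  { intros i. apply ex_series_dominated with (fun j => u i * v j); auto.
    now apply ex_series_scal_R. }
  assert (Hvu : forall j, ex_series (fun i => v j * u i)).
  { intros j. now apply ex_series_scal_R. }
  assert (Hcol : forall j, ex_series (fun i => a i j)).
  { intros j. apply ex_series_dominated with (fun i => v j * u i); auto.
    intros i. rewrite Rmult_comm. apply Ha. }
  assert (Hall : ex_series (fun j => Series (fun i => a i j))).
  { apply ex_series_dominated with (fun j => Series u * v j);
      [|now apply ex_series_scal_R].
    intros j. rewrite Rmult_comm, <- Series_scal_l. apply Series_dominated; auto.
    intros i. rewrite Rmult_comm. apply Ha. }
  apply is_series_unique.
  set (L := Series (fun j => Series (fun i => a i j))).
  assert (Hlim : is_lim_seq (sum_n (fun i => Series (a i))) L); [|exact Hlim].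
  assert (Hbound : forall N, Rabs (L - sum_n (fun i => Series (a i)) N)
                             <= Series v * (Series u - sum_n u N)).
  { intros N. destruct (Series_sum_n a N Hrow) as [Hex <-].
    unfold L. rewrite <- Series_minus by auto.
    rewrite Rmult_comm, <- Series_scal_l.
    apply Series_dominated; [|now apply ex_series_scal_R].
    (* In column [j] the difference is the tail of that column after row [N], bounded by [v j] times
       the tail of [u]. *)
    intros j. rewrite <- (Series_tail (fun i => a i j) N), <- Series_tail by auto.
    rewrite Rmult_comm, <- Series_scal_l.
    apply Series_dominated.
    - intros i. rewrite Rmult_comm. apply Ha.
    - apply ex_series_scal_R. now apply (ex_series_incr_n u (S N)). }
  assert (Hu0 : is_lim_seq (fun N => Series v * (Series u - sum_n u N)) 0).
  { replace (Finite 0) with (Rbar_mult (Series v) (Series u - Series u))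
      by (simpl; f_equal; ring).
    apply is_lim_seq_scal_l. apply is_lim_seq_minus'.
    - apply is_lim_seq_const.
    - exact (Series_correct u Hu). }
  apply is_lim_seq_ext with
    (fun N => L - (L - sum_n (fun i => Series (a i)) N)); [intros; ring|].
  replace L with (L - 0) at 1 by ring. apply is_lim_seq_minus'.
  - apply is_lim_seq_const.
  - apply is_lim_seq_abs_0.
    apply is_lim_seq_le_le with (2 := is_lim_seq_const 0) (3 := Hu0).
    intros N. split; [apply Rabs_pos | apply Hbound].
Qed.

(** * Complex series, handled through real and imaginary parts *)

Lemma im_le_Cmod (c : C) : Rabs (Im c) <= Cmod c.
Proof. eapply Rle_trans; [apply Rmax_r | apply Rmax_Cmod]. Qed.

Lemma ex_series_Re_Im (a : nat -> C) (u : nat -> R) :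
  (forall n, Cmod (a n) <= u n) -> ex_series u ->
  ex_series (fun n => Re (a n)) /\ ex_series (fun n => Im (a n)).
Proof.
  intros H Hu. split; apply ex_series_dominated with u; auto; intros n;
    (eapply Rle_trans; [|apply H]); [apply re_le_Cmod | apply im_le_Cmod].
Qed.

Lemma CSeries_ext (a b : nat -> C) :
  (forall n, a n = b n) -> CSeries a = CSeries b.
Proof.
  intros H. unfold CSeries. f_equal; apply Series_ext; intros n; now rewrite H.
Qed.

Lemma CSeries_plus (a b : nat -> C) (u v : nat -> R) :
  (forall n, Cmod (a n) <= u n) -> ex_series u ->
  (forall n, Cmod (b n) <= v n) -> ex_series v ->
  CSeries (fun n => a n + b n)%C = (CSeries a + CSeries b)%C.
Proof.
  intros Ha Hu Hb Hv.
  destruct (ex_series_Re_Im a u Ha Hu), (ex_series_Re_Im b v Hb Hv).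
  unfold CSeries, Cplus; simpl. f_equal; now apply Series_plus.
Qed.

Lemma CSeries_scal (c : C) (a : nat -> C) (u : nat -> R) :
  (forall n, Cmod (a n) <= u n) -> ex_series u ->
  CSeries (fun n => c * a n)%C = (c * CSeries a)%C.
Proof.
  intros Ha Hu. destruct (ex_series_Re_Im a u Ha Hu).
  unfold CSeries, Cmult; simpl. rewrite <- !Series_scal_l. f_equal.
  - apply Series_minus; now apply ex_series_scal_R.
  - apply Series_plus; now apply ex_series_scal_R.
Qed.

Lemma CSeries_incr_1 (a : nat -> C) (u : nat -> R) :
  (forall n, Cmod (a n) <= u n) -> ex_series u ->
  CSeries a = (a 0%nat + CSeries (fun n => a (S n)))%C.
Proof.
  intros Ha Hu. destruct (ex_series_Re_Im a u Ha Hu).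
  unfold CSeries, Cplus; simpl. f_equal; now apply Series_incr_1.
Qed.

(** The factor 2 comes from bounding the real and imaginary parts separately; this crude bound is
    enough to show that row sums are summable. *)
Lemma CSeries_Cmod (a : nat -> C) (u : nat -> R) :
  (forall n, Cmod (a n) <= u n) -> ex_series u ->
  Cmod (CSeries a) <= 2 * Series u.
Proof.
  intros Ha Hu.
  assert (HR : Rabs (Re (CSeries a)) <= Series u).
  { apply Series_dominated; auto. intros n.
    eapply Rle_trans; [apply re_le_Cmod | apply Ha]. }
  assert (HI : Rabs (Im (CSeries a)) <= Series u).
  { apply Series_dominated; auto. intros n.
    eapply Rle_trans; [apply im_le_Cmod | apply Ha]. }
  replace (CSeries a) with (Re (CSeries a) + Ci * Im (CSeries a))%C.
  - eapply Rle_trans; [apply Cmod_triangle|].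
    rewrite Cmod_mult, Cmod_Ci, !Cmod_R. lra.
  - destruct (CSeries a) as [x y].
    unfold Cplus, Cmult, Re, Im; simpl. f_equal; ring.
Qed.

Lemma CSeries_swap (a : nat -> nat -> C) (u v : nat -> R) :
  (forall i j, Cmod (a i j) <= u i * v j) -> ex_series u -> ex_series v ->
  CSeries (fun i => CSeries (a i)) = CSeries (fun j => CSeries (fun i => a i j)).
Proof.
  intros Ha Hu Hv. unfold CSeries; simpl. f_equal.
  - apply Series_swap with (a := fun i j => Re (a i j)) (u := u) (v := v); auto.
    intros i j. eapply Rle_trans; [apply re_le_Cmod | apply Ha].
  - apply Series_swap with (a := fun i j => Im (a i j)) (u := u) (v := v); auto.
    intros i j. eapply Rle_trans; [apply im_le_Cmod | apply Ha].
Qed.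

Lemma one_minus_neq_0 (z : C) : Cmod z < 1 -> (1 - z)%C <> 0.
Proof.
  intros Hz. apply Cminus_eq_contra. intros E. rewrite <- E, Cmod_1 in Hz. lra.
Qed.

(** Splitting off the first term shows that the sum [s] of the powers of [z] satisfies
    [s = 1 + z * s], which is solved for [s]. *)
Lemma CSeries_geom (c z : C) :
  Cmod z < 1 -> CSeries (fun n => c * z ^ n)%C = (c / (1 - z))%C.
Proof.
  intros Hz.
  assert (Hb : forall n, Cmod (z ^ n)%C <= Cmod z ^ n).
  { intros n. rewrite Cmod_pow. apply Rle_refl. }
  assert (Hex : ex_series (fun n => Cmod z ^ n)).
  { apply ex_series_geom. rewrite Rabs_pos_eq; auto. apply Cmod_ge_0. }
  rewrite (CSeries_scal _ _ _ Hb Hex).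
  assert (E : (CSeries (fun n => z ^ n) = 1 + z * CSeries (fun n => z ^ n))%C).
  { rewrite (CSeries_incr_1 _ _ Hb Hex) at 1.
    rewrite <- (CSeries_scal _ _ _ Hb Hex). f_equal. }
  assert (H1 := one_minus_neq_0 z Hz).
  set (s := CSeries (fun n => z ^ n)%C) in *.
  replace (c / (1 - z))%C with (c * (s - z * s) / (1 - z))%C.
  - field. exact H1.
  - rewrite E at 1. f_equal. ring.
Qed.

(** * Absolute convergence and bounds on the general terms *)

Lemma double_sum_converges_dominated (m : nat -> nat) (a : nat -> nat -> C)
    (u v : nat -> R) :
  (forall i j, Cmod (a (1 + i)%nat (m (1 + i) + j)%nat) <= u i * v j) ->
  ex_series u -> ex_series v -> double_sum_converges m a.
Proof.
  intros Ha Hu Hv. split.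
  - intros [|k] Hk; [lia|].
    apply ex_series_dominated with (fun j => u k * v j); [|now apply ex_series_scal_R].
    intros n. rewrite Rabs_pos_eq by apply Cmod_ge_0. apply Ha.
  - apply ex_series_dominated with (fun i => Series v * u i);
      [|now apply ex_series_scal_R].
    intros i. rewrite Rmult_comm, <- Series_scal_l.
    apply Series_dominated; [|now apply ex_series_scal_R].
    intros n. rewrite Rabs_pos_eq by apply Cmod_ge_0. apply Ha.
Qed.

(** Ratio test: the quotient of consecutive terms is [r + r / (n + 1)], which tends to [r]. *)
Lemma ex_series_S_pow (r : R) :
  0 < r < 1 -> ex_series (fun n => INR (S n) * r ^ n).
Proof.
  intros [Hr0 Hr1].
  assert (Hpos : forall n, 0 < INR (S n) * r ^ n).
  { intros n. apply Rmult_lt_0_compat; [apply lt_0_INR; lia | now apply pow_lt]. }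
  apply ex_series_ext with (fun n => Rabs (INR (S n) * r ^ n)).
  { intros n. apply Rabs_pos_eq. left. apply Hpos. }
  apply ex_series_DAlembert with r; auto.
  { intros n. apply Rgt_not_eq, Hpos. }
  apply is_lim_seq_ext with (fun n => r + r * / INR (S n)).
  { intros n.
    assert (0 < INR (S n)) by (apply lt_0_INR; lia).
    assert (0 < r ^ n) by now apply pow_lt.
    rewrite Rabs_pos_eq.
    - rewrite (S_INR (S n)). simpl pow. field. lra.
    - left. apply Rdiv_lt_0_compat; apply Hpos. }
  replace (Finite r) with (Finite (r + r * 0)) by (f_equal; ring).
  apply is_lim_seq_plus'; [apply is_lim_seq_const|].
  apply (is_lim_seq_scal_l _ r 0).
  apply (is_lim_seq_incr_1 (fun n => / INR n)).
  apply (is_lim_seq_inv INR p_infty); [apply is_lim_seq_INR | easy].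
Qed.

(** Since [r < 1], lowering the exponent only enlarges the bound. This lets complicated exponents be
    replaced by simple ones. *)
Lemma Cmod_pow_le (q : C) (r : R) (j n : nat) :
  Cmod q <= r -> r < 1 -> (j <= n)%nat -> Cmod (q ^ n)%C <= r ^ j.
Proof.
  intros Hq Hr Hj. rewrite Cmod_pow. assert (H0 := Cmod_ge_0 q).
  apply Rle_trans with (r ^ n); [apply pow_incr; lra|].
  replace n with (j + (n - j))%nat by lia.
  rewrite pow_add. rewrite <- (Rmult_1_r (r ^ j)) at 2.
  apply Rmult_le_compat_l; [apply pow_le; lra|].
  rewrite <- (pow1 (n - j)). apply pow_incr; lra.
Qed.

Lemma Cmod_one_minus_pow (q : C) (r : R) (k : nat) :
  Cmod q <= r -> r < 1 -> (1 <= k)%nat -> 1 - r <= Cmod (1 - q ^ k)%C.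
Proof.
  intros Hq Hr Hk.
  assert (H := Cmod_triangle (1 - q ^ k) (q ^ k)).
  replace (1 - q ^ k + q ^ k)%C with (RtoC 1) in H by ring.
  rewrite Cmod_1 in H.
  assert (H' := Cmod_pow_le q r 1 k Hq Hr Hk). rewrite pow_1 in H'. lra.
Qed.

Lemma one_minus_pow_neq_0 (q : C) (k : nat) :
  Cmod q < 1 -> (1 <= k)%nat -> (1 - q ^ k)%C <> 0.
Proof.
  intros Hq Hk. apply Cmod_gt_0.
  assert (H := Cmod_one_minus_pow q (Cmod q) k (Rle_refl _) Hq Hk). lra.
Qed.

Lemma Cmod_lambert_term (q : C) (r : R) (j n l : nat) :
  Cmod q <= r -> r < 1 -> (j <= n)%nat -> (1 <= l)%nat ->
  Cmod (q ^ n / (1 - q ^ l))%C <= / (1 - r) * r ^ j.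
Proof.
  intros Hq Hr Hj Hl.
  assert (H := Cmod_one_minus_pow q r l Hq Hr Hl).
  rewrite Cmod_div by (apply Cmod_gt_0; lra).
  unfold Rdiv. rewrite Rmult_comm.
  apply Rmult_le_compat; [| apply Cmod_ge_0 | |].
  - left. apply Rinv_0_lt_compat; lra.
  - apply Rinv_le_contravar; lra.
  - now apply Cmod_pow_le.
Qed.

(** One bound serves the terms of [f2], of [f3] and of their rearrangements. Here [i] and [j] are
    summation indices starting at 0, [c] is the integer weight, and the right-hand side is a
    function of [i] times a function of [j], as the interchange of sums demands. *)
Lemma Cmod_term (q : C) (r : R) (c i j n k l : nat) :
  Cmod q <= r -> r < 1 -> (c <= 2 * (S i * S j))%nat -> (i + j <= n)%nat ->
  (1 <= k)%nat -> (1 <= l)%nat ->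
  Cmod (INR c * q ^ n / ((1 - q ^ k) * (1 - q ^ l)))%C
  <= (2 / (1 - r) ^ 2 * (INR (S i) * r ^ i)) * (INR (S j) * r ^ j).
Proof.
  intros Hq Hr Hc Hn Hk Hl.
  assert (Hq1 : Cmod q < 1) by lra.
  assert (H0 := Cmod_ge_0 q).
  (* The factor [q ^ 0] puts the second quotient in the shape of [Cmod_lambert_term] as well. *)
  replace (INR c * q ^ n / ((1 - q ^ k) * (1 - q ^ l)))%C
    with (INR c * (q ^ n / (1 - q ^ k)) * (q ^ 0 / (1 - q ^ l)))%C
    by (simpl; field; split; now apply one_minus_pow_neq_0).
  rewrite !Cmod_mult, Cmod_R, Rabs_pos_eq by apply pos_INR.
  replace (2 / (1 - r) ^ 2 * (INR (S i) * r ^ i) * (INR (S j) * r ^ j))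
    with (2 * (INR (S i) * INR (S j)) * (/ (1 - r) * r ^ (i + j)) * (/ (1 - r) * r ^ 0))
    by (rewrite pow_add; simpl; field; lra).
  repeat apply Rmult_le_compat; try apply Rmult_le_pos;
    try apply Cmod_ge_0; try apply pos_INR; try now apply Cmod_lambert_term.
  rewrite <- mult_INR. change 2 with (INR 2). rewrite <- mult_INR. now apply le_INR.
Qed.

(** * Lambert series and the inner sums *)

(** Expanding each denominator as a geometric series turns the two sides into the two orders of
    summation of [q ^ ((1 + j) * (m + n))]. *)
Lemma lambert_tail (q : C) (m : nat) :
  Cmod q < 1 -> (1 <= m)%nat ->
  CSeries (fun j => q ^ ((1 + j) * m) / (1 - q ^ (1 + j)))%C
  = CSeries (fun n => q ^ (m + n) / (1 - q ^ (m + n)))%C.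
Proof.
  intros Hq Hm.
  assert (Hpow : forall k, (1 <= k)%nat -> Cmod (q ^ k)%C < 1).
  { intros k Hk. assert (H := Cmod_pow_le q (Cmod q) 1 k (Rle_refl _) Hq Hk). lra. }
  assert (Hex : ex_series (fun n => Cmod q ^ n)).
  { apply ex_series_geom. rewrite Rabs_pos_eq; auto. apply Cmod_ge_0. }
  transitivity (CSeries (fun j => CSeries (fun n => q ^ ((1 + j) * (m + n)))%C)).
  - apply CSeries_ext. intros j. rewrite <- CSeries_geom by (apply Hpow; lia).
    apply CSeries_ext. intros n.
    now rewrite <- Cpow_mult_r, <- Cpow_add_r, Nat.mul_add_distr_l.
  - rewrite CSeries_swap with (u := fun j => Cmod q ^ j) (v := fun n => Cmod q ^ n); auto.
    + apply CSeries_ext. intros n. rewrite <- CSeries_geom by (apply Hpow; lia).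
      apply CSeries_ext. intros j. rewrite <- Cpow_mult_r, <- Cpow_add_r.
      f_equal. lia.
    (* As [m >= 1], the exponent [(1 + j) * (m + n)] is at least [j + n]. *)
    + intros j n. rewrite <- pow_add. apply Cmod_pow_le; [apply Rle_refl | auto | nia].
Qed.

(** The share of [f2_term] that carries the weight [k]; exchanging [k] and [l] gives the share with
    weight [l]. *)
Definition half_term (q : C) (k l : nat) : C :=
  (INR k * q ^ (k + l + k * l) / ((1 - q ^ k) * (1 - q ^ l)))%C.

Lemma f2_term_split (q : C) (k l : nat) :
  f2_term q k l = (half_term q k l + half_term q l k)%C.
Proof.
  unfold f2_term, half_term, Cdiv.
  rewrite plus_INR, RtoC_plus, (Nat.add_comm l k), (Nat.mul_comm l k),
    (Cmult_comm (1 - q ^ l)).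
  ring.
Qed.

(** The exponent is [k + l * (k + 1)], so [q ^ k] factors out and [lambert_tail] applies with
    [m = k + 1]. *)
Lemma half_term_sum (q : C) (k : nat) :
  Cmod q < 1 -> (1 <= k)%nat ->
  CSeries (fun j => half_term q k (1 + j))
  = (INR k * q ^ k / (1 - q ^ k)
     * CSeries (fun n => q ^ (S k + n) / (1 - q ^ (S k + n))))%C.
Proof.
  intros Hq Hk. rewrite <- lambert_tail by (auto; lia).
  rewrite <- CSeries_scal with (u := fun j => / (1 - Cmod q) * Cmod q ^ j).
  - apply CSeries_ext. intros j. unfold half_term.
    replace (k + (1 + j) + k * (1 + j))%nat with (k + (1 + j) * S k)%nat by lia.
    rewrite Cpow_add_r. field. split; apply one_minus_pow_neq_0; auto; lia.
  - intros j. apply Cmod_lambert_term; [apply Rle_refl | auto | lia | lia].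
  - apply ex_series_scal_R, ex_series_geom.
    rewrite Rabs_pos_eq; auto. apply Cmod_ge_0.
Qed.

Lemma f3_term_sum (q : C) (k : nat) :
  Cmod q < 1 -> (1 <= k)%nat ->
  CSeries (fun n => f3_term q k (S k + n))
  = (2 * INR k * q ^ k / (1 - q ^ k)
     * CSeries (fun n => q ^ (S k + n) / (1 - q ^ (S k + n))))%C.
Proof.
  intros Hq Hk.
  rewrite <- CSeries_scal with (u := fun j => / (1 - Cmod q) * Cmod q ^ j).
  - apply CSeries_ext. intros j. unfold f3_term.
    rewrite (Cpow_add_r q k (S k + j)).
    field. split; apply one_minus_pow_neq_0; auto; lia.
  - intros j. apply Cmod_lambert_term; [apply Rle_refl | auto | lia | lia].
  - apply ex_series_scal_R, ex_series_geom.
    rewrite Rabs_pos_eq; auto. apply Cmod_ge_0.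
Qed.

Theorem theorem3p2 : forall q : C, (Cmod q < 1)%R ->
  double_sum_converges (fun _ => 1%nat) (f2_term q) /\
  double_sum_converges S (f3_term q) /\
  f2 q = f3 q.
Proof.
  intros q Hq. assert (H0 := Cmod_ge_0 q).
  (* [r > 0] even for [q = 0], as the ratio test behind [ex_series_S_pow] needs. *)
  set (r := (1 + Cmod q) / 2).
  assert (Hqr : Cmod q <= r) by (unfold r; lra).
  assert (Hr : 0 < r < 1) by (unfold r; lra).
  assert (Hr1 : r < 1) by apply Hr.
  set (v := fun n => INR (S n) * r ^ n).
  set (u := fun n => 2 / (1 - r) ^ 2 * v n).
  assert (Hv : ex_series v) by now apply ex_series_S_pow.
  assert (Hu : ex_series u) by now apply ex_series_scal_R.
  split; [|split].
  - apply double_sum_converges_dominated with u v; auto.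
    intros i j. apply Cmod_term; auto; nia.
  - apply double_sum_converges_dominated with u v; auto.
    (* The weight [2 * k] is gathered into a single natural number, the form that [Cmod_term]
       expects. *)
    intros i j. unfold f3_term. rewrite <- RtoC_mult.
    change 2 with (INR 2). rewrite <- mult_INR. apply Cmod_term; auto; nia.
  - assert (Hb : forall i j, Cmod (half_term q (1 + i) (1 + j)) <= u i * v j).
    { intros i j. apply Cmod_term; auto; nia. }
    assert (Hb' : forall i j, Cmod (half_term q (1 + j) (1 + i)) <= u i * v j).
    (* [u] is a constant multiple of [v], so [u i * v j] is symmetric in [i] and [j]. *)
    { intros i j. eapply Rle_trans; [apply Hb|]. unfold u. right. ring. }
    assert (Hrow : forall i, ex_series (fun j => u i * v j)).
    { intros i. now apply ex_series_scal_R. }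
    assert (HU : ex_series (fun i => 2 * Series (fun j => u i * v j))).
    { apply ex_series_scal_R.
      apply ex_series_ext with (fun i => Series v * u i); [|now apply ex_series_scal_R].
      intros i. now rewrite Series_scal_l, Rmult_comm. }
    assert (HA : forall i, Cmod (CSeries (fun j => half_term q (1 + i) (1 + j)))
                           <= 2 * Series (fun j => u i * v j)).
    { intros i. now apply CSeries_Cmod. }
    assert (HB : forall i, Cmod (CSeries (fun j => half_term q (1 + j) (1 + i)))
                           <= 2 * Series (fun j => u i * v j)).
    { intros i. now apply CSeries_Cmod. }
    unfold f2, f3, double_sum, sum_from.
    transitivity (CSeries (fun i => CSeries (fun j => half_term q (1 + i) (1 + j))
                                  + CSeries (fun j => half_term q (1 + j) (1 + i)))%C).
    { apply CSeries_ext. intros i.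
      rewrite <- CSeries_plus with (u := fun j => u i * v j) (v := fun j => u i * v j)
        by auto.
      apply CSeries_ext. intros j. apply f2_term_split. }
    rewrite (CSeries_plus _ _ _ _ HA HU HB HU).
    (* Interchanging the sums in the second half makes it equal to the first. Recombining row by row
       then gives twice the sum of [half_term] over each row, to be compared with the matching row
       of [f3]. *)
    rewrite (CSeries_swap (fun i j => half_term q (1 + j) (1 + i)) u v Hb' Hu Hv).
    rewrite <- (CSeries_plus _ _ _ _ HA HU HA HU).
    apply CSeries_ext. intros i.
    rewrite f3_term_sum, half_term_sum by (auto; lia).
    field. apply one_minus_pow_neq_0; auto; lia.
Qed.
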